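(* Let $R$ be a nonzero associative unital ring, let $n$ be a positive integer, let $G$ be a group with identity element $e$, and suppose that $S:=M_n(R)$ is equipped with a very good $G$-grading. For each $g\in G$, put $X_g:=\{i\in\{1,\ldots,n\}\mid \deg(v_i)=g\}$, where $\deg(v_i):=\deg(e_{i,1})$. If $|X_g|=|X_e|$ for every $g\in G$ with $X_g\neq\emptyset$, then $S$ is an epsilon-crossed product.
   Context: $M_n(R)$ is the ring of all $n\times n$ matrices with entries in $R$; $e_{i,j}$ denotes the matrix with $1$ in position $(i,j)$ and zeros elsewhere. A $G$-grading on a ring $S$ is a family of additive subgroups $S_g$ ($g\in G$) with $S=\bigoplus_{g\in G}S_g$ as additive groups and $S_gS_h\subseteq S_{gh}$ for all $g,h\in G$, where $S_gS_h$ denotes the set of all finite sums of products $st$ with $s\in S_g$, $t\in S_h$. For a nonzero $s\in S_g$ write $\deg(s):=g$. A $G$-grading on $S=M_n(R)$ is very good if for all $i,j\in\{1,\ldots,n\}$ there is $g\in G$ with $Re_{i,j}\subseteq S_g$. Here $v_1,\ldots,v_n$ is the fixed basis of the free left $R$-module $V=R^n$, with the degree $\deg(v_i):=\deg(e_{i,1})\in G$ assigned to $v_i$. A $G$-graded ring $S$ is epsilon-strongly $G$-graded if for every $g\in G$ there is some $\epsilon_g\in S_gS_{g^{-1}}$ such that $\epsilon_g s=s\epsilon_{g^{-1}}=s$ for every $s\in S_g$; the elements $\epsilon_g$ are then uniquely determined. An epsilon-strongly $G$-graded ring $S$ is an epsilon-crossed product if for every $g\in G$ there are $s_g\in S_g$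 and $t_{g^{-1}}\in S_{g^{-1}}$ such that $s_gt_{g^{-1}}=\epsilon_g$ and $t_{g^{-1}}s_g=\epsilon_{g^{-1}}$. *)

(* Defs.v *)
From mathcomp Require Import all_boot all_algebra.
From mathcomp Require Import boolp classical_sets cardinality fsbigop.

Set Implicit Arguments.
Unset Strict Implicit.
Unset Printing Implicit Defensive.

Import GRing.Theory.
Local Open Scope ring_scope.
Local Open Scope classical_set_scope.

Definition additive_subgroup (S : zmodType) (A : set S) : Prop :=
  A 0 /\ forall x y, A x -> A y -> A (x - y).

Definition set_prod (S : pzRingType) (A B : set S) : set S :=
  [set s | exists (k : nat) (a b : 'I_k -> S),
     [/\ forall i, A (a i), forall i, B (b i) & s = \sum_(i < k) a i * b i]].

Section Grading.
Variables (G : groupType) (S : pzRingType) (Sg : G -> set S).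

(* c is a decomposition of s in the (internal) sum of the S_g.  The bigop below
   ranges over the support of c, and is 0 for c of infinite support; hence the
   explicit finiteness condition. *)
Definition decomposes (s : S) (c : G -> S) : Prop :=
  [/\ forall g, Sg g (c g), finite_set [set g | c g != 0]
    & s = \sum_(g \in [set: G]) c g].

Definition is_grading : Prop :=
  [/\ forall g, additive_subgroup (Sg g),
      forall s, exists! c : G -> S, decomposes s c
    & forall g h, set_prod (Sg g) (Sg h) `<=` Sg (g * h)%g].

(* Meaningful only for nonzero homogeneous s, see deg_eq; otherwise the value is
   the default 1. *)
Definition deg (s : S) : G := xget 1%g [set g | s != 0 /\ Sg g s].

Definition epsilon_family (eps : G -> S) : Prop :=
  forall g, set_prod (Sg g) (Sg g^-1%g) (eps g) /\
    forall s, Sg g s -> eps g * s = s /\ s * eps g^-1%g = s.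

Definition epsilon_strongly_graded : Prop :=
  is_grading /\ exists eps, epsilon_family eps.

(* By epsilon_family_unique, there is only one eps to consider here. *)
Definition epsilon_crossed_product : Prop :=
  epsilon_strongly_graded /\
  forall eps, epsilon_family eps ->
  forall g, exists s t, [/\ Sg g s, Sg g^-1%g t, s * t = eps g
                          & t * s = eps g^-1%g].

Lemma deg_eq (s : S) (g : G) : is_grading -> s != 0 -> Sg g s -> deg s = g.
Proof.
move=> [sub dec _] s0 gs.
have D k : Sg k s -> decomposes s (fun h => if h == k then s else 0).
  move=> ks; split.
  - by move=> h; case: eqP => [->|_] //; case: (sub h).
  - apply: (@sub_finite_set _ _ [set k]); last exact: finite_set1.
    by move=> h /=; case: (h =P k) => // _; rewrite eqxx.
  - rewrite -(@fsbig_widen _ _ _ _ [set k]) ?fsbig_set1 ?eqxx //.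
    by move=> h [_ /eqP/negPf /= ->].
rewrite /deg; case: xgetP => [k _ [_ ks]|/(_ g)]; last by case.
have [c [_ cU]] := dec s.
have E := etrans (esym (cU _ (D k ks))) (cU _ (D g gs)).
have := congr1 (fun f => f k) E; rewrite /= eqxx; case: (k =P g) => // _ s00.
by rewrite s00 eqxx in s0.
Qed.

Lemma epsilon_family_unique (eps eps' : G -> S) :
  epsilon_family eps -> epsilon_family eps' -> eps = eps'.
Proof.
move=> E E'; apply/funext => g; transitivity (eps' g * eps g).
  have [[k [a [b [Aa Bb ->]]]] _] := E g.
  rewrite mulr_sumr; apply: eq_bigr => i _; rewrite mulrA.
  by have [_ /(_ _ (Aa i)) [-> _]] := E' g.
have [[k [a [b [Aa Bb ->]]]] _] := E' g.
rewrite mulr_suml; apply: eq_bigr => i _; rewrite -mulrA.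
by have [_ /(_ _ (Bb i)) [_]] := E g^-1%g; rewrite invgK => ->.
Qed.

End Grading.

Section MatrixGrading.
Variables (R : nzRingType) (n : nat) (G : groupType).
Variable Sg : G -> set 'M[R]_n.+1.

Definition very_good_grading : Prop :=
  is_grading Sg /\
  forall i j, exists g, [set r *: delta_mx i j | r in [set: R]] `<=` Sg g.

(* The basis v_1, ..., v_n is indexed from 0, so e_{i,1} is delta_mx i ord0. *)
Definition basis_deg (i : 'I_n.+1) : G := deg Sg (delta_mx i ord0).

Definition X (g : G) : {set 'I_n.+1} := [set i | basis_deg i == g]%SET.

End MatrixGrading.

(* Main.v *)
Require Import Defs.
From mathcomp Require Import all_boot all_algebra.
From mathcomp Require Import classical_sets.

(** With [d i = deg v_i], the component [S_g] consists of the matrices supported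
    on the positions [(i, j)] with [d i = g * d j].  When the nonempty fibres of
    [d] all have the same size, numbering each fibre gives compatible bijections
    between them: the partial permutation matrix [M_g] matching [i] with the [j]
    of the same rank in the fibre of [g^-1 * d i] (if that is nonempty) lies in
    [S_g], and [M_g * M_(g^-1)] is the diagonal idempotent [epsilon_g]. *)

Set Implicit Arguments.
Unset Strict Implicit.
Unset Printing Implicit Defensive.

Import GRing.Theory.
Local Open Scope ring_scope.

Section FibreRank.
Variables (I : finType) (T : eqType) (d : I -> T).

Definition fibre_rank (i : I) : nat := index i (enum [set j | d j == d i]%SET).

Lemma fibre_rank_inj i j : d i = d j -> fibre_rank i = fibre_rank j -> i = j.
Proof.
rewrite /fibre_rank => dij; rewrite dij => rij.
by apply: (index_inj i _ _ rij); rewrite mem_enum inE ?dij.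
Qed.

(** Equal cardinality makes the rank of [i] a valid index in the enumeration of the fibre of [j];
    [k] is the entry found there. *)
Lemma fibre_rank_surj i j :
    #|[set k | d k == d i]%SET| = #|[set k | d k == d j]%SET| ->
  exists k, d k = d j /\ fibre_rank k = fibre_rank i.
Proof.
move=> card_eq; set F := enum [set k | d k == d j]%SET.
have lt_i : (fibre_rank i < size F)%N.
  by rewrite -cardE -card_eq cardE index_mem mem_enum inE.
have := mem_nth i lt_i; rewrite mem_enum inE => /eqP dk.
exists (nth i F (fibre_rank i)); split => //.
by rewrite {1}/fibre_rank dk index_uniq ?enum_uniq.
Qed.

End FibreRank.

Section GradedRing.
Variables (G : groupType) (S : pzRingType) (Sg : G -> set S).
Hypothesis gradS : is_grading Sg.

Lemma grading0 g : Sg g 0.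
Proof. by case: gradS => /(_ g) []. Qed.

Lemma gradingD g x y : Sg g x -> Sg g y -> Sg g (x + y).
Proof.
case: gradS => /(_ g) [S0 SB] _ _ Sx Sy.
by rewrite -[y]opprK -[- y]sub0r; apply: (SB) => //; apply: SB.
Qed.

Lemma grading_sum g (J : finType) (F : J -> S) :
  (forall j, Sg g (F j)) -> Sg g (\sum_j F j).
Proof.
by move=> SF; apply: big_ind => //; [exact: grading0 | exact: gradingD].
Qed.

Lemma set_prodM (A B : set S) x y : A x -> B y -> set_prod A B (x * y).
Proof.
move=> Ax By; exists 1%N, (fun=> x), (fun=> y).
by split=> //; rewrite big_ord1.
Qed.

Lemma gradingM g h x y : Sg g x -> Sg h y -> Sg (g * h)%g (x * y).
Proof.
by case: gradS => _ _ SM Sx Sy; apply: SM; apply: set_prodM.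
Qed.

Lemma grading_degree_inj g h s : s != 0 -> Sg g s -> Sg h s -> g = h.
Proof.
by move=> s0 Sgs Shs; rewrite -(deg_eq gradS s0 Sgs) (deg_eq gradS s0 Shs).
Qed.

End GradedRing.

Section VeryGood.
Variables (R : nzRingType) (n : nat) (G : groupType).
Variable Sg : G -> set 'M[R]_n.+1.
Hypothesis vgood : very_good_grading Sg.

Let gradS : is_grading Sg := proj1 vgood.
Let d := basis_deg Sg.

Lemma delta_mx_neq0 (i j : 'I_n.+1) : delta_mx i j != 0 :> 'M[R]_n.+1.
Proof.
apply/eqP => /matrixP/(_ i j); rewrite !mxE !eqxx => /eqP.
by rewrite oner_eq0.
Qed.

Lemma basis_degP i : Sg (d i) (delta_mx i ord0).
Proof.
have [g Rg] := (proj2 vgood) i ord0.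
have Sgi : Sg g (delta_mx i ord0) by apply: Rg; exists 1; rewrite ?scale1r.
by rewrite /d /basis_deg (deg_eq gradS (delta_mx_neq0 _ _) Sgi).
Qed.

(** If [h] is the degree of [delta_mx i j], then e_ij * e_j1 = e_i1 is nonzero of degree both
    [h * d j] and [d i]; cancelling [d j] gives [h = g]. *)
Lemma scaled_delta_mx_degree i j g r :
  d i = (g * d j)%g -> Sg g (r *: delta_mx i j).
Proof.
move=> dij; have [h Rh] := (proj2 vgood) i j.
suff -> : g = h by apply: Rh; exists r.
have Shij : Sg h (delta_mx i j) by apply: Rh; exists 1; rewrite ?scale1r.
have := gradingM gradS Shij (basis_degP j).
rewrite -mulmxE mul_delta_mx => Shj.
apply: (@mulIg _ (d j)); rewrite -dij.
exact: (grading_degree_inj gradS (delta_mx_neq0 i ord0) (basis_degP i) Shj).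
Qed.

(* [s i j *: delta_mx i j] is [e_ii * s * e_jj], hence still of degree [g]. *)
Lemma homogeneous_support g s i j :
  Sg g s -> s i j != 0 -> d i = (g * d j)%g.
Proof.
move=> Ss sij0.
have S1 k : Sg 1%g (delta_mx k k).
  by rewrite -[delta_mx k k]scale1r; apply: scaled_delta_mx_degree; rewrite mul1g.
have := gradingM gradS (gradingM gradS (S1 i) Ss) (S1 j).
rewrite mul1g mulg1 -!mulmxE.
have -> : delta_mx i i *m s *m delta_mx j j = s i j *: delta_mx i j.
  apply/matrixP => a b; rewrite !mxE (bigD1 j) //= big1 => [|k kj].
    rewrite !mxE (bigD1 i) //= big1 => [|k ki].
      rewrite !mxE !eqxx andbT addr0 /= addr0.
      by case: (a == i); case: (b == j); rewrite ?mul1r ?mul0r ?mulr1 ?mulr0.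
    by rewrite !mxE (negPf ki) andbF mul0r.
  by rewrite !mxE (negPf kj) mulr0.
move=> Sgij.
have e0 : s i j *: delta_mx i j != 0 :> 'M_n.+1.
  apply: contraNneq sij0 => /matrixP/(_ i j).
  by rewrite !mxE !eqxx mulr1 => ->.
(* The unit e_ij has degree [d i * (d j)^-1], so uniqueness of the degree identifies this with
   [g]. *)
have dij : d i = (d i * (d j)^-1 * d j)%g by rewrite mulgVK.
by rewrite {1}dij; congr (_ * _)%g;
  apply: (grading_degree_inj gradS e0 (scaled_delta_mx_degree _ dij) Sgij).
Qed.

Lemma homogeneous_of_support g (s : 'M[R]_n.+1) :
  (forall i j, s i j != 0 -> d i = (g * d j)%g) -> Sg g s.
Proof.
move=> supp; rewrite [s]matrix_sum_delta.
apply: (grading_sum gradS) => i; apply: (grading_sum gradS) => j.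
have [->|/supp] := eqVneq (s i j) 0; last exact: scaled_delta_mx_degree.
by rewrite scale0r; apply: (grading0 gradS).
Qed.

Definition rank_mx (g : G) : 'M[R]_n.+1 :=
  \matrix_(i, j) ((d i == g * d j)%g && (fibre_rank d i == fibre_rank d j))%:R.

Lemma rank_mx_homogeneous g : Sg g (rank_mx g).
Proof.
apply: homogeneous_of_support => i j; rewrite mxE.
by case: (d i =P _) => // _; rewrite eqxx.
Qed.

Hypothesis card_fibres :
  forall g : G, X Sg g <> finset.set0 -> #|X Sg g| = #|X Sg 1%g|.

Lemma card_fibre i : #|[set k | d k == d i]%SET| = #|X Sg 1%g|.
Proof.
by apply: card_fibres => /setP/(_ i); rewrite !inE eqxx.
Qed.

(** Entry [(i, k)] counts the [j] with the rank of both [i] and [k], [d i = g * d j] and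
    [d j = g^-1 * d k]. Such a [j] forces [i = k], and on the diagonal at most one exists, since
    degree and rank determine an index. *)
Lemma rank_mxM g :
  rank_mx g * rank_mx g^-1%g =
  diag_mx (\row_i [exists j, d i == g * d j]%g%:R).
Proof.
apply/matrixP => i k; rewrite -mulmxE !mxE.
under eq_bigr => j _ do rewrite !mxE -natrM mulnb.
have [<-{k}|ik] := eqVneq i k; last first.
  rewrite big1 // => j _.
  case: eqP => //= di; case: eqP => //= ri; case: eqP => //= dj.
  case: eqP => //= rj; case/eqP: ik.
  by apply: (@fibre_rank_inj _ _ d); rewrite ?ri // di dj mulVKg.
rewrite mulr1n; case: existsP => [[j0 /eqP di]|nex]; last first.
  by rewrite big1 // => j _; case: eqP => //= di; case: nex; exists j; rewrite di.
(* [j0] only shows that the fibre is nonempty; the surviving term is at the [j] in that fibre with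
   the rank of [i]. *)
have [j [dj rj]] : exists j, d j = d j0 /\ fibre_rank d j = fibre_rank d i.
  by apply: fibre_rank_surj; rewrite !card_fibre.
rewrite (bigD1 j) //= big1 => [|k kj].
  by rewrite dj rj di mulKg !eqxx addr0.
case: eqP => //= dk; case: eqP => //= rk; case/eqP: kj.
apply: (@fibre_rank_inj _ _ d); last by rewrite -rk rj.
by apply: (@mulgI _ g); rewrite -dk dj.
Qed.

(** A nonzero entry [s i j] gives [d i = g * d j], so [j] witnesses a 1 at place [i] of the left
    idempotent; as [d j = g^-1 * d i], [i] witnesses a 1 at place [j] of the right one. *)
Lemma rank_mx_epsilon :
  epsilon_family Sg (fun g => rank_mx g * rank_mx g^-1%g).
Proof.
move=> g; split.
  by apply: set_prodM; apply: rank_mx_homogeneous.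
move=> s Ss; rewrite !rank_mxM -!mulmxE mul_diag_mx mul_mx_diag.
split; apply/matrixP => i j; rewrite !mxE;
  have [->|/(homogeneous_support Ss) dij] := eqVneq (s i j) 0;
  rewrite ?mulr0 ?mul0r //; case: existsP; rewrite ?mul1r ?mulr1 //.
  by case; exists j; rewrite dij.
by case; exists i; rewrite dij mulKg.
Qed.

End VeryGood.

Theorem theorem2p11 (R : nzRingType) (n : nat) (G : groupType)
    (Sg : G -> set 'M[R]_n.+1) :
  very_good_grading Sg ->
  (forall g : G, X Sg g <> finset.set0 -> #|X Sg g| = #|X Sg 1%g|) ->
  epsilon_crossed_product Sg.
Proof.
move=> vgood cardX; have epsP := rank_mx_epsilon vgood cardX.
split.
  by split; [exact: vgood.1 | exists (fun g => rank_mx Sg g * rank_mx Sg g^-1%g)].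
(* By uniqueness, an arbitrary epsilon family is the one built from the rank matrices. *)
move=> eps /(epsilon_family_unique epsP) <- g.
exists (rank_mx Sg g), (rank_mx Sg g^-1%g).
by split; rewrite ?invgK //; apply: rank_mx_homogeneous.
Qed.
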